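(* Let $\mathbb{D}\in\{\mathbb{R},\mathbb{C},\mathbb{H}\}$, let $\sigma$ be a Kubo-Ando mean on $\mathscr{P}_3(\mathbb{D})$ with representing function $f$, let $A,B\in\mathscr{P}_3(\mathbb{D})$ and let $X=A^{-1/2}BA^{-1/2}$. Suppose that $|\mathrm{Spec}(X)|=3$. Then $$A\,\sigma\,B=c_0A+c_1B+c_2BA^{-1}B,$$ where $$c_0=\frac{f(\lambda_1)\lambda_2\lambda_3}{(\lambda_1-\lambda_2)(\lambda_1-\lambda_3)}-\frac{f(\lambda_2)\lambda_1\lambda_3}{(\lambda_1-\lambda_2)(\lambda_2-\lambda_3)}+\frac{f(\lambda_3)\lambda_1\lambda_2}{(\lambda_1-\lambda_3)(\lambda_2-\lambda_3)},$$ $$c_1=-\frac{f(\lambda_1)(\lambda_2+\lambda_3)}{(\lambda_1-\lambda_2)(\lambda_1-\lambda_3)}+\frac{f(\lambda_2)(\lambda_1+\lambda_3)}{(\lambda_1-\lambda_2)(\lambda_2-\lambda_3)}-\frac{f(\lambda_3)(\lambda_1+\lambda_2)}{(\lambda_1-\lambda_3)(\lambda_2-\lambda_3)},$$ $$c_2=\frac{f(\lambda_1)}{(\lambda_1-\lambda_2)(\lambda_1-\lambda_3)}-\frac{f(\lambda_2)}{(\lambda_1-\lambda_2)(\lambda_2-\lambda_3)}+\frac{f(\lambda_3)}{(\lambda_1-\lambda_3)(\lambda_2-\lambda_3)},$$ and where $\lambda_1,\lambda_2,\lambda_3$ depend only on $\det(X)$, $\mathrm{tr}(X)$ and $\mathrm{tr}(X^2)$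 and are given by $$\lambda_{k+1}=\frac{T}{3}+2\sqrt{-\frac{p}{3}}\,\cos\!\left(\frac{\theta+2k\pi}{3}\right),\quad k=0,1,2,\qquad \theta=\arccos\!\left(-\frac{q}{2}\Big(-\frac{3}{p}\Big)^{3/2}\right),$$ with $$T=\mathrm{tr}(X),\quad S=\frac{\mathrm{tr}(X)^2-\mathrm{tr}(X^2)}{2},\quad D=\det(X),\quad p=S-\frac{T^2}{3},\quad q=-\frac{2T^3}{27}+\frac{TS}{3}-D.$$
   Context: $\mathscr{P}_n(\mathbb{D})$ is the set of $n\times n$ matrices $A$ over $\mathbb{D}$ that are Hermitian ($A=A^*$, with $A^*$ the conjugate transpose) and positive ($x^*Ax>0$ for all nonzero $x\in\mathbb{D}^n$). $\mathrm{Spec}(X)$ is the set of eigenvalues of $X$ (right eigenvalues $\lambda$, $Xv=v\lambda$ with $v\neq 0$, when $\mathbb{D}=\mathbb{H}$), without multiplicity. For a continuous $f:(0,\infty)\to\mathbb{R}$ and $X=U\,\mathrm{diag}(\lambda_1,\dots,\lambda_n)\,U^*\in\mathscr{P}_n(\mathbb{D})$ with $UU^*=\mathrm{Id}_n$, set $f(X)=U\,\mathrm{diag}(f(\lambda_1),\dots,f(\lambda_n))\,U^*$. For $X\in\mathscr{P}_n(\mathbb{D})$, $\mathrm{tr}(X)$ is the sum and $\det(X)$ the product of the eigenvalues of $X$ counted with multiplicity (this is the meaning of $\det$ when $\mathbb{D}=\mathbb{H}$). A Kubo-Ando mean on $\mathscr{P}_n(\mathbb{D})$ is a continuous map $\sigma:\mathscr{P}_n(\mathbb{D})\times\mathscr{P}_n(\mathbb{D})\to\mathscr{P}_n(\mathbb{D})$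 that is monotone in both arguments for the Loewner order, satisfies $g(A\,\sigma\,B)g^*=(gAg^* )\,\sigma\,(gBg^* )$ for all $g\in\mathrm{GL}_n(\mathbb{D})$, and satisfies $\mathrm{Id}_n\,\sigma\,\mathrm{Id}_n=\mathrm{Id}_n$. By the Kubo-Ando correspondence, used throughout, it is given by $A\,\sigma\,B=A^{1/2}f(A^{-1/2}BA^{-1/2})A^{1/2}$ for a unique operator monotone function $f:(0,\infty)\to(0,\infty)$ with $f(1)=1$, called its representing function. *)

(* Defs.v *)
From HB Require Import structures.
From mathcomp Require Import all_boot all_order all_algebra.
From mathcomp Require Import ring.
From mathcomp Require Import complex.
From mathcomp Require Import all_classical all_reals all_analysis.

Set Implicit Arguments.
Unset Strict Implicit.
Unset Printing Implicit Defensive.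

Import Order.TTheory GRing.Theory Num.Theory.
Import numFieldNormedType.Exports.

Local Open Scope classical_set_scope.
Local Open Scope ring_scope.

(* No multiplication-continuity axiom: the topology only serves to express
   the continuity of a mean. *)
HB.mixin Record hasConjugation (R : numDomainType) A of GRing.Algebra R A := {
  star : A -> A;
  starK : involutive star;
  starD : {morph star : x y / x + y};
  starZ : forall (a : R) x, star (a *: x) = a *: star x;
  starM : forall x y, star (x * y) = star y * star x
}.

#[short(type="starAlgType")]
HB.structure Definition StarAlgebra (R : numDomainType) :=
  {A of GRing.Algebra R A & Topological A & hasConjugation R A}.

HB.instance Definition _ (R : realType) :=
  @hasConjugation.Build R R^o id (fun=> erefl) (fun _ _ => erefl)
    (fun _ _ => erefl) (fun x y : R => mulrC x y).

(* [Rcomplex R] is the alias of [R[i]] that is a module over [R] rather than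
   over itself. *)

Section Complex.
Variable R : realType.
Local Notation C := (Rcomplex R).

HB.instance Definition _ := GRing.Lalgebra_isComAlgebra.Build R C.
HB.instance Definition _ := Topological.copy C (R[i] : numFieldType)%C.

Definition starC (z : C) : C := conjc z.

Fact starC_K : involutive starC. Proof. exact: conjcK. Qed.
Fact starC_D : {morph starC : x y / x + y}.
Proof. by move=> [a b] [c d]; rewrite /starC /= opprD. Qed.
Fact starC_Z (a : R) x : starC (a *: x) = a *: starC x.
Proof. by case: x => b c; exact: (congr2 (@Complex R) erefl (esym (mulrN a c))). Qed.
Fact starC_M x y : starC (x * y) = starC y * starC x.
Proof.
by case: x y => [a b] [c d]; congr Complex; rewrite /=; ring.
Qed.

HB.instance Definition _ :=
  hasConjugation.Build R C starC_K starC_D starC_Z starC_M.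
End Complex.

(* [Quat a b c d] stands for a + b i + c j + d k. *)

Record quat (R : realType) : Type :=
  Quat { quat1 : R; quati : R; quatj : R; quatk : R }.

Section Quaternion.
Variable R : realType.
Local Notation H := (quat R).
Implicit Types x y z : H.

Definition quat_coords x : R * R * R * R :=
  (quat1 x, quati x, quatj x, quatk x).
Definition quat_of_coords (u : R * R * R * R) : H :=
  let: (a, b, c, d) := u in Quat a b c d.
Fact quat_coordsK : cancel quat_coords quat_of_coords. Proof. by case. Qed.

HB.instance Definition _ := Choice.copy H (can_type quat_coordsK).
HB.instance Definition _ := Topological.copy H (initial_topology quat_coords).

Definition addH x y : H :=
  Quat (quat1 x + quat1 y) (quati x + quati y)
       (quatj x + quatj y) (quatk x + quatk y).
Definition oppH x : H :=
  Quat (- quat1 x) (- quati x) (- quatj x) (- quatk x).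
Definition scaleH (r : R) x : H :=
  Quat (r * quat1 x) (r * quati x) (r * quatj x) (r * quatk x).
Definition mulH x y : H :=
  let: Quat a1 b1 c1 d1 := x in
  let: Quat a2 b2 c2 d2 := y in
  Quat (a1 * a2 - b1 * b2 - c1 * c2 - d1 * d2)
       (a1 * b2 + b1 * a2 + c1 * d2 - d1 * c2)
       (a1 * c2 - b1 * d2 + c1 * a2 + d1 * b2)
       (a1 * d2 + b1 * c2 - c1 * b2 + d1 * a2).
Definition starH x : H := let: Quat a b c d := x in Quat a (- b) (- c) (- d).

Fact addH_A : associative addH.
Proof. by move=> [????] [????] [????]; congr Quat => /=; ring. Qed.
Fact addH_C : commutative addH.
Proof. by move=> [????] [????]; congr Quat => /=; ring. Qed.
Fact add0H : left_id (Quat 0 0 0 0) addH.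
Proof. by move=> [????]; congr Quat => /=; ring. Qed.
Fact addNH : left_inverse (Quat 0 0 0 0) oppH addH.
Proof. by move=> [????]; congr Quat => /=; ring. Qed.
HB.instance Definition _ := GRing.isZmodule.Build H addH_A addH_C add0H addNH.

Fact mulH_A : associative mulH.
Proof. by move=> [????] [????] [????]; congr Quat => /=; ring. Qed.
Fact mul1H : left_id (Quat 1 0 0 0) mulH.
Proof. by move=> [????]; congr Quat => /=; ring. Qed.
Fact mulH1 : right_id (Quat 1 0 0 0) mulH.
Proof. by move=> [????]; congr Quat => /=; ring. Qed.
Fact mulH_Dl : left_distributive mulH +%R.
Proof. by move=> [????] [????] [????]; congr Quat => /=; ring. Qed.
Fact mulH_Dr : right_distributive mulH +%R.
Proof. by move=> [????] [????] [????]; congr Quat => /=; ring. Qed.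
Fact oneH_neq0 : Quat 1 0 0 0 != 0 :> H.
Proof. by apply/eqP => -[] /eqP; rewrite oner_eq0. Qed.
HB.instance Definition _ := GRing.Zmodule_isNzRing.Build H
  mulH_A mul1H mulH1 mulH_Dl mulH_Dr oneH_neq0.

Fact scaleH_A a b x : scaleH a (scaleH b x) = scaleH (a * b) x.
Proof. by case: x => ????; congr Quat => /=; ring. Qed.
Fact scale1H : left_id 1 scaleH.
Proof. by move=> [????]; congr Quat => /=; ring. Qed.
Fact scaleH_Dr : right_distributive scaleH +%R.
Proof. by move=> ? [????] [????]; congr Quat => /=; ring. Qed.
Fact scaleH_Dl x : {morph scaleH^~ x : a b / a + b}.
Proof. by case: x => ???? ? ?; congr Quat => /=; ring. Qed.
HB.instance Definition _ := GRing.Zmodule_isLmodule.Build R H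
  scaleH_A scale1H scaleH_Dr scaleH_Dl.

Fact scaleH_Al (a : R) x y : a *: (x * y) = a *: x * y.
Proof. by case: x y => [????] [????]; congr Quat => /=; ring. Qed.
HB.instance Definition _ := GRing.Lmodule_isLalgebra.Build R H scaleH_Al.

Fact scaleH_Ar (a : R) x y : a *: (x * y) = x * (a *: y).
Proof. by case: x y => [????] [????]; congr Quat => /=; ring. Qed.
HB.instance Definition _ := GRing.Lalgebra_isAlgebra.Build R H scaleH_Ar.

Fact starH_K : involutive starH.
Proof. by move=> [????]; congr Quat => /=; ring. Qed.
Fact starH_D : {morph starH : x y / x + y}.
Proof. by move=> [????] [????]; congr Quat => /=; ring. Qed.
Fact starH_Z (a : R) x : starH (a *: x) = a *: starH x.
Proof. by case: x => ????; congr Quat => /=; ring. Qed.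
Fact starH_M x y : starH (x * y) = starH y * starH x.
Proof. by case: x y => [????] [????]; congr Quat => /=; ring. Qed.
HB.instance Definition _ :=
  hasConjugation.Build R H starH_K starH_D starH_Z starH_M.
End Quaternion.

Variant scalar_kind := RealScalars | ComplexScalars | QuaternionScalars.

Definition scalars (R : realType) (k : scalar_kind) : starAlgType R :=
  match k with
  | RealScalars => R^o
  | ComplexScalars => Rcomplex R
  | QuaternionScalars => quat R
  end.

Section Matrices.
Variables (R : realType) (D : starAlgType R).

Definition adjmx m n (A : 'M[D]_(m, n)) : 'M[D]_(n, m) :=
  map_mx (@star R D) A^T.
Local Notation "A ^*t" := (adjmx A) (at level 8, format "A ^*t").

Definition hermitian n (A : 'M[D]_n) : Prop := A = A^*t.

(* [x^*t *m A *m x] is a 1 x 1 matrix over [D]; to be (strictly) positive is to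
   be a (strictly) positive real scalar. *)
Definition posdef n : set 'M[D]_n := [set A | hermitian A /\
  forall x : 'cV[D]_n, x != 0 ->
    exists2 r : R, 0 < r & (x^*t *m A *m x) ord0 ord0 = r%:A].

Definition possemidef n : set 'M[D]_n := [set A | hermitian A /\
  forall x : 'cV[D]_n,
    exists2 r : R, 0 <= r & (x^*t *m A *m x) ord0 ord0 = r%:A].

Definition loewner n (A B : 'M[D]_n) : Prop := possemidef (B - A).

Definition inverse_of n (A C : 'M[D]_n) : Prop :=
  A *m C = 1%:M /\ C *m A = 1%:M.

(* [invmx] and [unitmx] require commutative coefficients. *)
Definition invertible n (A : 'M[D]_n) : Prop := exists C, inverse_of A C.

Definition mxinv n (A : 'M[D]_n) : 'M[D]_n := xget 0 [set C | inverse_of A C].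

Definition Spec n (X : 'M[D]_n) : set D :=
  [set l | exists2 v : 'cV[D]_n, v != 0 & X *m v = v *m l%:M].

Definition real_diag n (l : 'rV[R]_n) : 'M[D]_n :=
  diag_mx (map_mx (fun r : R => r%:A) l).

Definition diagonalizes n (X U : 'M[D]_n) (l : 'rV[R]_n) : Prop :=
  U *m U^*t = 1%:M /\ X = U *m real_diag l *m U^*t.

(* A positive matrix is diagonalizable, and neither [mxfun f X] nor the multiset
   of the coefficients of [eigenvalues X] depends on the diagonalization;
   both take a default value when there is no diagonalization. *)
Definition mxfun (f : R -> R) n (X : 'M[D]_n) : 'M[D]_n :=
  xget 0 [set Y | exists U l,
    diagonalizes X U l /\ Y = U *m real_diag (map_mx f l) *m U^*t].

Definition eigenvalues n (X : 'M[D]_n) : 'rV[R]_n :=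
  xget 0 [set l | exists U, diagonalizes X U l].

Definition eigtr n (X : 'M[D]_n) : R := \sum_i eigenvalues X ord0 i.

Definition eigdet n (X : 'M[D]_n) : R := \prod_i eigenvalues X ord0 i.

Definition mxpow n (A : 'M[D]_n) (a : R) : 'M[D]_n :=
  mxfun (fun t => t `^ a) A.

(* A map defined on the positive matrices is represented by a function on all
   pairs of matrices, of which only the values on positive ones matter. *)
Record kubo_ando_mean n (sigma : 'M[D]_n -> 'M[D]_n -> 'M[D]_n) : Prop := {
  mean_posdef : forall A B, posdef A -> posdef B -> posdef (sigma A B);
  mean_continuous : {within (@posdef n) `*` (@posdef n),
    continuous (fun AB : 'M[D]_n * 'M[D]_n => sigma AB.1 AB.2)};
  mean_monotone : forall A A' B B',
    posdef A -> posdef A' -> posdef B -> posdef B' ->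
    loewner A A' -> loewner B B' -> loewner (sigma A B) (sigma A' B');
  mean_congruence : forall g A B, invertible g -> posdef A -> posdef B ->
    g *m sigma A B *m g^*t = sigma (g *m A *m g^*t) (g *m B *m g^*t);
  mean_id : sigma 1%:M 1%:M = 1%:M
}.

(* Monotone for matrices over [D] of every size; for the real, complex and
   quaternion scalars these are equivalent conditions.  The values of [f]
   outside (0, +oo) are irrelevant. *)
Definition operator_monotone (f : R -> R) : Prop :=
  forall n (A B : 'M[D]_n), posdef A -> posdef B ->
    loewner A B -> loewner (mxfun f A) (mxfun f B).

Record representing_function n (sigma : 'M[D]_n -> 'M[D]_n -> 'M[D]_n)
    (f : R -> R) : Prop := {
  repr_gt0 : forall t, 0 < t -> 0 < f t;
  repr_monotone : operator_monotone f;
  repr_1 : f 1 = 1;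
  repr_mean : forall A B, posdef A -> posdef B ->
    sigma A B
    = mxpow A 2^-1 *m mxfun f (mxpow A (- 2^-1) *m B *m mxpow A (- 2^-1))
      *m mxpow A 2^-1
}.

End Matrices.

(* Main.v *)
(* Put P = A^(-1/2) and Q = A^(1/2), so that X = P B P.  On the three distinct
   eigenvalues of X the function f agrees with its quadratic Lagrange
   interpolant, hence f(X) = c0 + c1 X + c2 X^2, and conjugating by Q turns
   1, X, X^2 into A, B, B A^-1 B.  The eigenvalues are the roots of the cubic
   x^3 - T x^2 + S x - D, which has a nonnegative discriminant and is solved by
   the triple angle formula for the cosine.  Over the quaternions the real part
   of the trace, which is cyclic, replaces the trace. *)

Require Import Defs.
From HB Require Import structures.
From mathcomp Require Import all_boot all_order all_algebra.
From mathcomp Require Import ring lra.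
From mathcomp Require Import complex.
From mathcomp Require Import all_classical all_reals all_analysis.

Set Implicit Arguments.
Unset Strict Implicit.
Unset Printing Implicit Defensive.

Import Order.TTheory GRing.Theory Num.Theory.
Import numFieldNormedType.Exports.

Local Open Scope classical_set_scope.
Local Open Scope card_scope.
Local Open Scope ring_scope.

(** * Cosines of thirds of a turn and the trigonometric solution of the cubic *)

Lemma cos_mulr3n (R : realType) (x : R) :
  cos (x *+ 3) = 4 * cos x ^+ 3 - 3 * cos x.
Proof.
rewrite mulrS cosD cos_mulr2n sin_mulr2n.
have := sin2cos2 x; rewrite expr2 => s2.
have -> : sin x * (cos x * sin x *+ 2) = cos x * (sin x * sin x) *+ 2 by ring.
by rewrite s2; ring.
Qed.

(** Tripling the angle gives a full turn, so the cosine c satisfies (c - 1)(2c + 1)^2 = 0, and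
    injectivity of [cos] on [0, pi] excludes c = 1. *)
Lemma cos_2pi3 (R : realType) : cos (2 * pi / 3) = - 2^-1 :> R.
Proof.
have pi0 := pi_gt0 R.
have c1 : cos (2 * pi / 3 : R) != 1.
  rewrite -[X in _ != X]cos0; apply/eqP => e.
  have : 2 * pi / 3 = 0 :> R by apply: (cos_inj _ _ e); rewrite !in_itv/=; lra.
  by lra.
have := cos_mulr3n (2 * pi / 3 : R).
rewrite (_ : _ *+ 3 = pi *+ 2 :> R); last by rewrite -mulr_natr -[RHS]mulr_natr; field.
rewrite cos2pi; set c := cos _ in c1 * => h.
have : (c - 1) * (2 * c + 1) ^+ 2 = 0 by lra.
move/eqP; rewrite mulf_eq0 subr_eq0 (negPf c1) sqrf_eq0/= => /eqP; lra.
Qed.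

(* The three angles differ by thirds of a turn, so the cosines are the roots
   of [4 y^3 - 3 y - cos theta]; comparing the factored polynomials, rather than
   the roots, makes no use of distinctness. *)
Lemma cos_third_prod (R : realType) (theta y : R) :
  let c (j : nat) := cos ((theta + 2 * j%:R * pi) / 3) in
  4 * ((y - c 0%N) * (y - c 1%N) * (y - c 2%N)) = 4 * y ^+ 3 - 3 * y - cos theta.
Proof.
move=> c.
have e0 : theta = (theta / 3) *+ 3 by rewrite -mulr_natr; field.
rewrite [in RHS]e0 cos_mulr3n /c.
have -> : (theta + 2 * 0%:R * pi) / 3 = theta / 3 by field.
have -> : (theta + 2 * 1%:R * pi) / 3 = theta / 3 + 2 * pi / 3 by field.
have -> : (theta + 2 * 2%:R * pi) / 3 = theta / 3 + (2 * pi / 3) *+ 2.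
  by rewrite -mulr_natr; field.
have su2 := sin2cos2 (2 * pi / 3 : R); rewrite cos_2pi3 in su2.
have st2 := sin2cos2 (theta / 3).
rewrite !(cosD (theta / 3)) cos_mulr2n sin_mulr2n cos_2pi3.
set ct := cos _ in st2 *; set st := sin (theta / 3) in st2 *.
set s := sin (2 * pi / 3) in su2 *.
(* The last two roots differ only in the sign of [st * s], so the product of their factors is a
   difference of squares in which the sines occur only squared. *)
have -> : (y - ct) * (y - (ct * - 2^-1 - st * s)) *
   (y - (ct * ((- 2^-1) ^+ 2 *+ 2 - 1) - st * ((- 2^-1 * s) *+ 2)))
   = (y - ct) * ((y + ct / 2) ^+ 2 - st ^+ 2 * s ^+ 2) by field.
by rewrite st2 su2; field.
Qed.

(** With r = sqrt(-p/3) and t = x - T/3 = 2 r y, the depressed cubic t^3 + p t + q becomes 2 r^3 (4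
    y^3 - 3 y - cos theta), whose roots y are the three cosines. *)
Lemma cardano_trigonometric (R : realType) (T S d x : R) :
  let p := S - T ^+ 2 / 3 in
  let q := - (2 * T ^+ 3 / 27) + T * S / 3 - d in
  let theta := acos (- (q / 2) * (- (3 / p)) `^ (3 / 2)) in
  let lambda (j : nat) : R :=
    T / 3 + 2 * Num.sqrt (- (p / 3)) * cos ((theta + 2 * j%:R * pi) / 3) in
  p < 0 -> 4 * p ^+ 3 + 27 * q ^+ 2 <= 0 ->
  (x - lambda 0%N) * (x - lambda 1%N) * (x - lambda 2%N)
  = x ^+ 3 - T * x ^+ 2 + S * x - d.
Proof.
move=> p q theta lambda p0 disc.
pose r := Num.sqrt (- (p / 3)).
have r0 : 0 < r by rewrite sqrtr_gt0; lra.
have r2 : r ^+ 2 = - (p / 3) by rewrite sqr_sqrtr//; lra.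
have rne : r != 0 by rewrite gt_eqF.
have pE : p = - 3 * r ^+ 2 by lra.
have powE : (- (3 / p)) `^ (3 / 2) = (r ^+ 3)^-1.
  have -> : - (3 / p) = (r ^+ 2)^-1 by rewrite pE; field.
  have y0 : 0 <= (r ^+ 2)^-1 by rewrite invr_ge0 sqr_ge0.
  rewrite mulrC powRrM powR12_sqrt// -exprVn sqrtr_sqr powR_mulrn//.
  by rewrite gtr0_norm ?invr_gt0// exprVn.
(* The bound on the discriminant, rewritten in [r], is what puts the argument of [acos] in
   [-1, 1]. *)
have qE : 4 * r ^+ 6 - q ^+ 2 >= 0.
  have -> : r ^+ 6 = (r ^+ 2) ^+ 3 by rewrite -exprM.
  by rewrite r2; lra.
have cosE : cos theta = - (q / 2) / r ^+ 3.
  rewrite /theta powE acosK// in_itv/= -ler_norml.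
  rewrite -(@ler_pXn2r _ 2)// ?nnegrE// real_normK ?num_real// expr1n.
  rewrite expr_div_n sqrrN -exprM ler_pdivrMr ?exprn_gt0// mul1r.
  by rewrite expr_div_n; lra.
have qr : q = - 2 * r ^+ 3 * cos theta by rewrite cosE; field.
have := cos_third_prod theta ((x - T / 3) / (2 * r)).
rewrite /lambda -/r.
set c0 := cos _; set c1 := cos _; set c2 := cos _ => h.
have -> : (x - (T / 3 + 2 * r * c0)) * (x - (T / 3 + 2 * r * c1)) *
   (x - (T / 3 + 2 * r * c2)) =
   2 * r ^+ 3 * (4 * (((x - T / 3) / (2 * r) - c0) *
     ((x - T / 3) / (2 * r) - c1) * ((x - T / 3) / (2 * r) - c2))).
  by field.
rewrite h cosE.
have -> : 2 * r ^+ 3 * (4 * ((x - T / 3) / (2 * r)) ^+ 3 -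
   3 * ((x - T / 3) / (2 * r)) - - (q / 2) / r ^+ 3) =
   (x - T / 3) ^+ 3 - 3 * r ^+ 2 * (x - T / 3) + q by field.
by rewrite r2 /p /q; field.
Qed.

(* [- (4 p ^ 3 + 27 q ^ 2)] is the discriminant of the cubic. *)
Lemma cardano_roots (R : realType) (a b c x : R) :
  let T := a + b + c in
  let S := (T ^+ 2 - (a ^+ 2 + b ^+ 2 + c ^+ 2)) / 2 in
  let d := a * b * c in
  let p := S - T ^+ 2 / 3 in
  let q := - (2 * T ^+ 3 / 27) + T * S / 3 - d in
  let theta := acos (- (q / 2) * (- (3 / p)) `^ (3 / 2)) in
  let lambda (j : nat) : R :=
    T / 3 + 2 * Num.sqrt (- (p / 3)) * cos ((theta + 2 * j%:R * pi) / 3) in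
  a != b ->
  (x - lambda 0%N) * (x - lambda 1%N) * (x - lambda 2%N)
  = (x - a) * (x - b) * (x - c).
Proof.
move=> T S d p q theta lambda ab.
rewrite (@cardano_trigonometric _ T S d x) -/p -/q.
- by rewrite /S /d /T; field.
(* -6 p is the sum of the squares of the three differences of a, b and c. *)
- have : 0 < (a - b) ^+ 2 by rewrite exprn_even_gt0// subr_eq0.
  have := sqr_ge0 (b - c); have := sqr_ge0 (a - c); rewrite /p /S /T; lra.
- have := sqr_ge0 ((a - b) * (b - c) * (a - c)).
  have -> : 4 * p ^+ 3 + 27 * q ^+ 2 = - ((a - b) * (b - c) * (a - c)) ^+ 2.
    by rewrite /p /q /S /d /T; field.
  by lra.
Qed.

(** * Interpolation at three points and distinctness from cardinality *)

(** The right-hand side is the Lagrange interpolant of [y] at the nodes a, b, c, sorted by powers of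
    x; this is where the coefficients c0, c1, c2 come from. *)
Lemma lagrange3 (F : fieldType) (y : F -> F) (a b c x : F) :
  a != b -> a != c -> b != c -> x \in [:: a; b; c] ->
  y x =
    (y a * b * c / ((a - b) * (a - c)) - y b * a * c / ((a - b) * (b - c))
     + y c * a * b / ((a - c) * (b - c)))
    + (- (y a * (b + c) / ((a - b) * (a - c)))
       + y b * (a + c) / ((a - b) * (b - c))
       - y c * (a + b) / ((a - c) * (b - c))) * x
    + (y a / ((a - b) * (a - c)) - y b / ((a - b) * (b - c))
       + y c / ((a - c) * (b - c))) * x ^+ 2.
Proof.
rewrite -!(subr_eq0 a) -(subr_eq0 b) !inE => ab ac bc /or3P[] /eqP ->; field;
by rewrite ab ac bc.
Qed.

(** A coincidence would put the set inside a pair, which has at most two elements. *)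
Lemma card3_neq (T : Type) (x y z : T) :
  [set x; y; z] #= `I_3 -> [/\ x <> y, x <> z & y <> z].
Proof.
have two (u v : T) : [set x; y; z] `<=` [set u; v] -> ~ ([set x; y; z] #= `I_3).
  move=> sub; rewrite card_eq_sym card_eq_le => /andP[le3 _].
  have : `I_3 #<= `I_2.
    apply: card_le_trans le3 _; apply: card_le_trans (subset_card_le sub) _.
    have -> : [set u; v] = (fun i => if i == 0%N then u else v) @` `I_2.
      apply/seteqP; split=> [w [] ->|_ [i _ <-]]; [by exists 0%N|by exists 1%N|].
      by case: eqP => _; [left|right].
    exact: card_image_le.
  by rewrite card_le_II.
move=> c3; split=> e; case: c3; [apply: (two y z)|apply: (two y z)|apply: (two x z)];
by move=> w [[->|->]|->]; rewrite ?e /=; auto.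
Qed.

(** * Conjugate transposes and real diagonal matrices over an algebra with conjugation *)

Section StarAlgebra.
Variables (R : realType) (D : starAlgType R).

Lemma star0 : star (0 : D) = 0.
Proof. by apply: (addrI (star 0)); rewrite -starD !addr0. Qed.

Lemma starN (x : D) : star (- x) = - star x.
Proof. by rewrite -scaleN1r starZ scaleN1r. Qed.

Lemma star_sum (I : Type) (r : seq I) (P : pred I) (F : I -> D) :
  star (\sum_(i <- r | P i) F i) = \sum_(i <- r | P i) star (F i).
Proof. exact: (big_morph _ (@starD R D) star0). Qed.

(** Antimultiplicativity and involutivity suffice: star 1 = star 1 * star (star 1) = star (star 1 *
    1) = 1. *)
Lemma star1 : star (1 : D) = 1.
Proof. by rewrite -[LHS]mulr1 -[X in _ * X](starK 1) -starM mulr1 starK. Qed.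

Lemma realA_comm (r : R) (x : D) : x * r%:A = r%:A * x.
Proof. by rewrite -scalerAr mulr1 -scalerAl mul1r. Qed.

Lemma realA_inj : injective (fun r : R => r%:A : D).
Proof.
move=> r s /eqP; rewrite -subr_eq0 -scalerBl scaler_eq0 oner_eq0 orbF subr_eq0.
by move/eqP.
Qed.

Lemma adjmxM m n p (A : 'M[D]_(m, n)) (B : 'M[D]_(n, p)) :
  adjmx (A *m B) = adjmx B *m adjmx A.
Proof.
apply/matrixP => i j; rewrite !mxE star_sum; apply: eq_bigr => l _.
by rewrite !mxE starM.
Qed.

Lemma adjmxK m n (A : 'M[D]_(m, n)) : adjmx (adjmx A) = A.
Proof. by apply/matrixP => i j; rewrite !mxE starK. Qed.

Lemma adjmxB m n (A B : 'M[D]_(m, n)) : adjmx (A - B) = adjmx A - adjmx B.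
Proof. by apply/matrixP => i j; rewrite !mxE starD starN. Qed.

Lemma adjmx1 n : adjmx (1%:M : 'M[D]_n) = 1%:M.
Proof.
by apply/matrixP => i j; rewrite !mxE eq_sym; case: eqP; rewrite ?star1 ?star0.
Qed.

Lemma real_diagM n (l m : 'rV[R]_n) :
  real_diag D l *m real_diag D m = real_diag D (\row_i (l ord0 i * m ord0 i)).
Proof.
rewrite /real_diag mulmx_diag; congr diag_mx; apply/rowP => i; rewrite !mxE.
by rewrite -scalerAl mul1r scalerA.
Qed.

Lemma real_diag1 n : real_diag D (const_mx 1 : 'rV[R]_n) = 1%:M.
Proof. by apply/matrixP => i j; rewrite !mxE scale1r. Qed.

(** The scalars need not commute, but a real multiple of the unit is central and passes through
    [A]. *)
Lemma mulmx_realZ m n p (r : R) (A : 'M[D]_(m, n)) (B : 'M[D]_(n, p)) :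
  A *m (r%:A *: B) = r%:A *: (A *m B).
Proof.
apply/matrixP => i j; rewrite !mxE mulr_sumr; apply: eq_bigr => l _.
by rewrite !mxE !mulrA realA_comm.
Qed.

(** In size zero the zero matrix is vacuously positive, hence [n.+1]; the all-ones column serves as
    a nonzero test vector. *)
Lemma posdef_neq0 n (A : 'M[D]_n.+1) : posdef A -> A != 0.
Proof.
move=> [_ /(_ (const_mx 1))[]].
  by apply/eqP => /matrixP/(_ ord0 ord0)/eqP; rewrite !mxE oner_eq0.
move=> r r0 Ar; apply/eqP => A0; move: Ar; rewrite A0 mulmx0 mul0mx mxE.
move/esym/eqP; rewrite scaler_eq0 oner_eq0 orbF => /eqP r00.
by rewrite r00 ltxx in r0.
Qed.

End StarAlgebra.

(** * Real part, norm and trace over the three kinds of scalars *)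

Section Scalars.
Variables (R : realType) (k : scalar_kind).
Local Notation D := (scalars R k).

Definition realpart : D -> R :=
  match k return scalars R k -> R with
  | RealScalars => fun x => x
  | ComplexScalars => fun x : Rcomplex R => complex.Re x
  | QuaternionScalars => fun x : quat R => quat1 x
  end.

Definition sqnorm (x : D) : R := realpart (star x * x).

Lemma realpartD : {morph realpart : x y / x + y}.
Proof. by rewrite /realpart; case: k => //= -[? ?] [? ?]. Qed.

Lemma realpartZ (r : R) (x : D) : realpart (r *: x) = r * realpart x.
Proof. by move: x; rewrite /realpart; case: k => //= -[]. Qed.

Lemma realpart1 : realpart 1 = 1.
Proof. by rewrite /realpart; case: k. Qed.

Lemma realpartC (x y : D) : realpart (x * y) = realpart (y * x).
Proof.
move: x y; rewrite /realpart; case: k => /= [x y|[? ?] [? ?]|[????] [????]] /=.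
- exact: mulrC.
- ring.
- ring.
Qed.

Lemma sqnormE (x : D) : star x * x = (sqnorm x)%:A.
Proof.
rewrite /sqnorm /realpart; move: x; case: k => /= [x|[a b]|[a b c d]].
- by rewrite /GRing.scale/= mulr1.
- by congr Complex; rewrite /=; ring.
- by congr Quat; rewrite /=; ring.
Qed.

Lemma sqnorm_ge0 (x : D) : 0 <= sqnorm x.
Proof.
rewrite /sqnorm /realpart; move: x; case: k => /= [x|[a b]|[a b c d]] /=.
- exact: sqr_ge0.
- nra.
- nra.
Qed.

Lemma sqnorm_eq0 (x : D) : sqnorm x = 0 -> x = 0.
Proof.
rewrite /sqnorm /realpart; move: x; case: k => /= [x|[a b]|[a b c d]] /=.
- by move/eqP; rewrite mulf_eq0 orbb => /eqP.
- move=> h.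
  have a0 : a = 0 by nra.
  have b0 : b = 0 by nra.
  by rewrite a0 b0.
- move=> h.
  have a0 : a = 0 by nra.
  have b0 : b = 0 by nra.
  have c0 : c = 0 by nra.
  have d0 : d = 0 by nra.
  by rewrite a0 b0 c0 d0.
Qed.

Lemma realpart0 : realpart (0 : D) = 0.
Proof. by rewrite -(scale0r 0) realpartZ mul0r. Qed.

Lemma realpart_sum (I : Type) (r : seq I) (P : pred I) (F : I -> D) :
  realpart (\sum_(i <- r | P i) F i) = \sum_(i <- r | P i) realpart (F i).
Proof. exact: (big_morph _ realpartD realpart0). Qed.

Lemma realpartA (r : R) : realpart (r%:A : D) = r.
Proof. by rewrite realpartZ realpart1 mulr1. Qed.

(** Cyclicity survives noncommuting scalars because the real part of a product does not see the
    order of its two factors. *)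
Lemma realpart_tr_mulC m n (A : 'M[D]_(m, n)) (B : 'M[D]_(n, m)) :
  realpart (\tr (A *m B)) = realpart (\tr (B *m A)).
Proof.
rewrite /mxtrace !realpart_sum.
under eq_bigr do rewrite mxE realpart_sum.
under [RHS]eq_bigr do rewrite mxE realpart_sum.
rewrite exchange_big; apply: eq_bigr => i _; apply: eq_bigr => j _.
exact: realpartC.
Qed.

(** This trace is the squared Frobenius norm, the sum of the squared norms of the entries. *)
Lemma realpart_tr_adj_eq0 m n (A : 'M[D]_(m, n)) :
  realpart (\tr (adjmx A *m A)) = 0 -> A = 0.
Proof.
have -> : realpart (\tr (adjmx A *m A)) = \sum_i \sum_j sqnorm (A j i).
  rewrite /mxtrace realpart_sum; apply: eq_bigr => i _.
  by rewrite mxE realpart_sum; apply: eq_bigr => j _; rewrite !mxE.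
move=> /eqP; rewrite psumr_eq0; last first.
  by move=> i _; apply: sumr_ge0 => j _; exact: sqnorm_ge0.
move=> /allP h; apply/matrixP => j i; rewrite mxE; apply/sqnorm_eq0/eqP.
have := h i (mem_index_enum i); rewrite /= psumr_eq0; last first.
  by move=> l _; exact: sqnorm_ge0.
by move/allP/(_ j (mem_index_enum j)).
Qed.

(* [1 - U^* U] is an orthogonal projection of trace zero. *)
Lemma unitary_adjmxK n (U : 'M[D]_n) :
  U *m adjmx U = 1%:M -> adjmx U *m U = 1%:M.
Proof.
move=> UU; set P := 1%:M - adjmx U *m U.
have Padj : adjmx P = P by rewrite /P adjmxB adjmx1 adjmxM adjmxK.
have PP : P *m P = P.
  rewrite {1}/P mulmxBl mul1mx /P mulmxBr mulmx1.
  by rewrite -!mulmxA (mulmxA U) UU mul1mx subrr subr0.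
have : P = 0.
  apply: realpart_tr_adj_eq0; rewrite Padj PP /P raddfB /= -scaleN1r.
  by rewrite realpartD realpartZ (realpart_tr_mulC (adjmx U)) UU mulN1r subrr.
by move/eqP; rewrite subr_eq0 => /eqP.
Qed.

(** * Unitary diagonalization and the functional calculus *)

Lemma real_diag_mul m n (l : 'rV[R]_m) (W : 'M[D]_(m, n)) i j :
  (real_diag D l *m W) i j = (l ord0 i)%:A * W i j.
Proof. by rewrite /real_diag mul_diag_mx !mxE. Qed.

Lemma mul_real_diag m n (l : 'rV[R]_n) (W : 'M[D]_(m, n)) i j :
  (W *m real_diag D l) i j = (l ord0 j)%:A * W i j.
Proof. by rewrite /real_diag mul_mx_diag !mxE realA_comm. Qed.

(** Entrywise the hypothesis says that W_ij = 0 or l_i = l'_j, and either alternative gives the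
    conclusion for an arbitrary [f]. *)
Lemma real_diag_intertwine (f : R -> R) m n (l : 'rV[R]_m) (l' : 'rV[R]_n)
    (W : 'M[D]_(m, n)) :
  real_diag D l *m W = W *m real_diag D l' ->
  real_diag D (map_mx f l) *m W = W *m real_diag D (map_mx f l').
Proof.
move=> /matrixP h; apply/matrixP => i j; move: (h i j).
rewrite !real_diag_mul !mul_real_diag !mxE -!scalerAl !mul1r => /eqP.
rewrite -subr_eq0 -scalerBl scaler_eq0 subr_eq0 => /orP[/eqP->//|/eqP->].
by rewrite !scaler0.
Qed.

(** The change of basis U^* U' intertwines the two diagonals, hence also their images under [f].
    Thus [mxfun] is independent of the diagonalization. *)
Lemma diagonalizes_fun (f : R -> R) n (X U U' : 'M[D]_n) (l l' : 'rV[R]_n) :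
  diagonalizes X U l -> diagonalizes X U' l' ->
  U *m real_diag D (map_mx f l) *m adjmx U
  = U' *m real_diag D (map_mx f l') *m adjmx U'.
Proof.
move=> [UU XU] [UU' XU'].
have WW : real_diag D l *m (adjmx U *m U') = adjmx U *m U' *m real_diag D l'.
  have : adjmx U *m X *m U' = adjmx U *m X *m U' by [].
  rewrite {1}XU XU' !mulmxA (unitary_adjmxK UU) mul1mx.
  by rewrite -!mulmxA (unitary_adjmxK UU') mulmx1.
have {WW} := real_diag_intertwine f WW.
move=> /(congr1 (fun Z => U *m Z *m adjmx U')).
rewrite !mulmxA UU mul1mx => <-.
by rewrite -!mulmxA UU' mulmx1.
Qed.

Lemma mxfunE (f : R -> R) n (X U : 'M[D]_n) (l : 'rV[R]_n) :
  diagonalizes X U l ->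
  mxfun f X = U *m real_diag D (map_mx f l) *m adjmx U.
Proof.
move=> XU; rewrite /mxfun; case: xgetP => [_ -> [U' [l' [XU' ->]]]|NP].
  exact: diagonalizes_fun XU' XU.
by case: (NP (U *m real_diag D (map_mx f l) *m adjmx U)); exists U, l.
Qed.

Lemma mxfun_neq0 (f : R -> R) n (X : 'M[D]_n) :
  mxfun f X != 0 -> exists U l, diagonalizes X U l.
Proof.
rewrite /mxfun; case: xgetP => [Y _ [U [l [XU _]]] _|_]; first by exists U, l.
by rewrite eqxx.
Qed.

(** * Trace, positivity and spectrum in terms of a diagonalization *)

Lemma eigenvaluesP n (X U : 'M[D]_n) (l : 'rV[R]_n) :
  diagonalizes X U l -> exists V, diagonalizes X V (eigenvalues X).
Proof.
by move=> XU; rewrite /eigenvalues; case: xgetP => // /(_ l)[]; exists U.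
Qed.

(** Both sides equal the real part of the matrix trace, which by cyclicity is the same for every
    diagonalization, the selected one included. *)
Lemma eigtrE n (X U : 'M[D]_n) (l : 'rV[R]_n) :
  diagonalizes X U l -> eigtr X = \sum_i l ord0 i.
Proof.
have tr V m : diagonalizes X V m -> realpart (\tr X) = \sum_i m ord0 i.
  move=> [VV ->]; rewrite realpart_tr_mulC mulmxA (unitary_adjmxK VV) mul1mx.
  rewrite /mxtrace realpart_sum; apply: eq_bigr => i _.
  by rewrite !mxE eqxx mulr1n realpartA.
by move=> XU; have [V /tr XV] := eigenvaluesP XU; rewrite /eigtr -XV (tr _ _ XU).
Qed.

Lemma diagonalizes_mulmx n (X U : 'M[D]_n) (l : 'rV[R]_n) :
  diagonalizes X U l ->
  diagonalizes (X *m X) U (\row_i (l ord0 i ^+ 2)).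
Proof.
move=> [UU ->]; split=> //.
rewrite !mulmxA -[_ *m adjmx U *m U]mulmxA (unitary_adjmxK UU) mulmx1.
by rewrite -[U *m _ *m _]mulmxA real_diagM.
Qed.

Lemma delta_mx_neq0 n (i : 'I_n) : delta_mx i ord0 != 0 :> 'cV[D]_n.
Proof.
by apply/eqP => /matrixP/(_ i ord0)/eqP; rewrite !mxE !eqxx oner_eq0.
Qed.

Lemma unitary_mul_neq0 n (U : 'M[D]_n) (v : 'cV[D]_n) :
  adjmx U *m U = 1%:M -> v != 0 -> U *m v != 0.
Proof.
move=> UU; apply: contra_neq => /(congr1 (mulmx (adjmx U))).
by rewrite mulmxA UU mul1mx mulmx0.
Qed.

Lemma adjmx_delta n (i : 'I_n) :
  adjmx (delta_mx i ord0 : 'cV[D]_n) = delta_mx ord0 i.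
Proof.
apply/matrixP => a b; rewrite !mxE andbC.
by case: andP; rewrite ?star1 ?star0.
Qed.

(** The quadratic form of X takes the value l_i at the i-th column of U. *)
Lemma posdef_eigenvalue_gt0 n (X U : 'M[D]_n) (l : 'rV[R]_n) i :
  posdef X -> diagonalizes X U l -> 0 < l ord0 i.
Proof.
move=> [_ pX] [UU XU]; have UU' := unitary_adjmxK UU.
have [r r0] := pX _ (unitary_mul_neq0 UU' (delta_mx_neq0 i)).
rewrite adjmxM XU !mulmxA -[_ *m adjmx U *m U]mulmxA UU' mulmx1.
rewrite -[_ *m adjmx U *m U]mulmxA UU' mulmx1 adjmx_delta.
rewrite -rowE -colE !mxE eqxx mulr1n.
by move/realA_inj => ->.
Qed.

(** Over the quaternions right eigenvalues come in conjugacy classes; here each class is a single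
    point because the diagonal entries are real, hence central. *)
Lemma Spec_diagonalizes n (X U : 'M[D]_n) (l : 'rV[R]_n) :
  diagonalizes X U l -> Spec X = [set (l ord0 i)%:A | i in [set: 'I_n]].
Proof.
move=> [UU XU]; have UU' := unitary_adjmxK UU.
apply/seteqP; split=> [x [v v0 Xv]|_ [i _ <-]].
- have w0 : adjmx U *m v != 0 by apply: unitary_mul_neq0; rewrite ?adjmxK.
  have wE : real_diag D l *m (adjmx U *m v) = adjmx U *m v *m x%:M.
    by rewrite -[RHS]mulmxA -Xv XU !mulmxA UU' mul1mx.
  move: (adjmx U *m v) w0 wE => w w0 wE.
  have [i wi0] : exists i, w i ord0 != 0.
    apply/existsP; apply: contraNT w0 => /existsPn h; apply/eqP/colP => i.
    by rewrite mxE; apply/eqP; have := h i; rewrite negbK.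
  exists i => //; move/matrixP/(_ i ord0): wE.
  rewrite real_diag_mul mxE big_ord1 [x%:M _ _]mxE mulr1n -realA_comm.
  (* Multiplying w_i l_i = w_i x on the left by the conjugate of w_i leaves the nonzero real factor
     |w_i|^2, which cancels without commutativity. *)
  move/(congr1 (fun y => star (w i ord0) * y)).
  rewrite !mulrA sqnormE -!scalerAl !mul1r => /eqP.
  rewrite -subr_eq0 -scalerBr scaler_eq0 subr_eq0.
  case/orP => [/eqP/sqnorm_eq0 wi|/eqP //].
  by rewrite wi eqxx in wi0.
- exists (U *m delta_mx i ord0); first exact/unitary_mul_neq0/delta_mx_neq0.
  rewrite XU -!mulmxA; congr (U *m _).
  rewrite !mulmxA -[_ *m adjmx U *m U]mulmxA UU' mulmx1.
  apply/matrixP => a b; rewrite (ord1 b) real_diag_mul [RHS]mxE big_ord1 !mxE.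
  rewrite !eqxx mulr1n andbT realA_comm.
  by case: eqP => [->|_]; rewrite ?mulr0.
Qed.

End Scalars.

(** * Inverses and conjugation by a square root *)

Lemma inverse_of_inj (R : realType) (D : starAlgType R) n (A B C : 'M[D]_n) :
  inverse_of A B -> inverse_of A C -> B = C.
Proof.
by move=> [_ BA1] [AC1 _]; rewrite -[B]mulmx1 -AC1 mulmxA BA1 mul1mx.
Qed.

Lemma mxinvE (R : realType) (D : starAlgType R) n (A B : 'M[D]_n) :
  inverse_of A B -> mxinv A = B.
Proof.
move=> AB; apply: (@inverse_of_inj _ _ _ A) => //.
by rewrite /mxinv; case: xgetP => // /(_ B).
Qed.

(** Since A^-1 = P^2 and Q X Q = B, the product B A^-1 B is (Q X Q) P^2 (Q X Q), whose inner factors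
    cancel to Q X^2 Q. *)
Lemma conj_quadratic (R : realType) (D : starAlgType R) n (A B P Q : 'M[D]_n)
    (c0 c1 c2 : R) :
  Q *m Q = A -> inverse_of P Q ->
  let X := P *m B *m P in
  Q *m (c0%:A *: 1%:M + c1%:A *: X + c2%:A *: (X *m X)) *m Q
  = c0%:A *: A + c1%:A *: B + c2%:A *: (B *m mxinv A *m B).
Proof.
move=> QQ [PQ QP] X.
have AV : mxinv A = P *m P.
  apply: mxinvE; rewrite -QQ; split; rewrite !mulmxA.
    by rewrite -[_ *m Q *m P]mulmxA QP mulmx1.
  by rewrite -[_ *m P *m Q]mulmxA PQ mulmx1.
have QXQ : Q *m X *m Q = B by rewrite /X !mulmxA QP mul1mx -mulmxA PQ mulmx1.
have QXXQ : Q *m (X *m X) *m Q = B *m mxinv A *m B.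
  rewrite AV -QXQ; move: X {QXQ} => X.
  by rewrite !mulmxA -[_ *m Q *m P]mulmxA QP mulmx1 -[_ *m P *m Q]mulmxA PQ mulmx1.
by rewrite !mulmxDr !mulmxDl !mulmx_realZ -!scalemxAl mulmx1 QQ QXQ QXXQ.
Qed.

(** * Powers of positive matrices and quadratic functions of a matrix *)

Section Powers.
Variables (R : realType) (k : scalar_kind).
Local Notation D := (scalars R k).

Lemma mxpowD n (A U : 'M[D]_n) (l : 'rV[R]_n) (a b : R) :
  posdef A -> diagonalizes A U l ->
  mxpow A a *m mxpow A b = mxpow A (a + b).
Proof.
move=> pA AU; have [UU _] := AU; rewrite /mxpow !(mxfunE _ AU) !mulmxA.
rewrite -[_ *m adjmx U *m U]mulmxA (unitary_adjmxK UU) mulmx1.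
rewrite -[U *m _ *m _]mulmxA real_diagM; congr (_ *m real_diag D _ *m _).
apply/rowP => i; rewrite !mxE powRD//.
(* For exponents with sum zero the power law can fail at base 0; positivity of the eigenvalues
   excludes that base. *)
by rewrite (gt_eqF (posdef_eigenvalue_gt0 i pA AU)) implybT.
Qed.

Lemma mxpow0 n (A U : 'M[D]_n) (l : 'rV[R]_n) :
  diagonalizes A U l -> mxpow A 0 = 1%:M.
Proof.
move=> AU; have [UU _] := AU; rewrite /mxpow (mxfunE _ AU).
rewrite (_ : map_mx _ l = const_mx 1) ?real_diag1 ?mulmx1//.
by apply/rowP => i; rewrite !mxE powRr0.
Qed.

Lemma mxpow1 n (A U : 'M[D]_n) (l : 'rV[R]_n) :
  posdef A -> diagonalizes A U l -> mxpow A 1 = A.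
Proof.
move=> pA AU; have [UU AE] := AU; rewrite /mxpow (mxfunE _ AU) [RHS]AE.
congr (_ *m real_diag D _ *m _); apply/rowP => i; rewrite !mxE powRr1//.
exact/ltW/(posdef_eigenvalue_gt0 i pA AU).
Qed.

(** The matrices 1, X and X^2 are diagonal in the same basis, so only the values of [f] at the
    eigenvalues count. *)
Lemma mxfun_quadratic (f : R -> R) (c0 c1 c2 : R) n (X U : 'M[D]_n)
    (l : 'rV[R]_n) :
  diagonalizes X U l ->
  (forall i, f (l ord0 i) = c0 + c1 * l ord0 i + c2 * l ord0 i ^+ 2) ->
  mxfun f X = c0%:A *: 1%:M + c1%:A *: X + c2%:A *: (X *m X).
Proof.
move=> XU fl; have [UU XE] := XU; have [_ XXE] := diagonalizes_mulmx XU.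
have conjZ r M : r%:A *: (U *m M *m adjmx U) = U *m (r%:A *: M) *m adjmx U.
  by rewrite mulmx_realZ scalemxAl.
have oneE : 1%:M = U *m 1%:M *m adjmx U by rewrite mulmx1.
rewrite (mxfunE _ XU) XXE XE {1}oneE !conjZ -!mulmxDl -!mulmxDr.
congr (_ *m _ *m _); apply/matrixP => i j; rewrite !mxE fl.
case: eqP => _; rewrite ?mulr0n ?mulr0 ?addr0// !mulr1n.
by rewrite mulr1 -!scalerAl !mul1r !scalerA !scalerDl.
Qed.

End Powers.

(** * The trigonometric roots as spectrum of X, and the resulting formula for the mean *)

Theorem theorem5p4 (R : realType) (k : scalar_kind)
    (sigma : 'M[scalars R k]_3 -> 'M[scalars R k]_3 -> 'M[scalars R k]_3)
    (f : R -> R) (A B : 'M[scalars R k]_3) :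
  kubo_ando_mean sigma -> representing_function sigma f ->
  posdef A -> posdef B ->
  let X := mxpow A (- 2^-1) *m B *m mxpow A (- 2^-1) in
  Spec X #= `I_3 ->
  let T := eigtr X in
  let S := (eigtr X ^+ 2 - eigtr (X *m X)) / 2 in
  let d := eigdet X in
  let p := S - T ^+ 2 / 3 in
  let q := - (2 * T ^+ 3 / 27) + T * S / 3 - d in
  let theta := acos (- (q / 2) * (- (3 / p)) `^ (3 / 2)) in
  let lambda (j : nat) : R :=
    T / 3 + 2 * Num.sqrt (- (p / 3)) * cos ((theta + 2 * j%:R * pi) / 3) in
  let l1 := lambda 0%N in
  let l2 := lambda 1%N in
  let l3 := lambda 2%N in
  let c0 := f l1 * l2 * l3 / ((l1 - l2) * (l1 - l3))
          - f l2 * l1 * l3 / ((l1 - l2) * (l2 - l3))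
          + f l3 * l1 * l2 / ((l1 - l3) * (l2 - l3)) in
  let c1 := - (f l1 * (l2 + l3) / ((l1 - l2) * (l1 - l3)))
          + f l2 * (l1 + l3) / ((l1 - l2) * (l2 - l3))
          - f l3 * (l1 + l2) / ((l1 - l3) * (l2 - l3)) in
  let c2 := f l1 / ((l1 - l2) * (l1 - l3))
          - f l2 / ((l1 - l2) * (l2 - l3))
          + f l3 / ((l1 - l3) * (l2 - l3)) in
  Spec X = [set l1%:A; l2%:A; l3%:A] /\
  sigma A B = c0%:A *: A + c1%:A *: B + c2%:A *: (B *m mxinv A *m B).
Proof.
move=> mean repr pA pB X cardX T S d p q theta lambda l1 l2 l3 c0 c1 c2.
have sAB := repr_mean repr pA pB; rewrite -/X in sAB.
(* [mxfun] takes the value 0 at a matrix without diagonalization, so the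
   positivity of [sigma A B] makes [A] and [X] diagonalizable: no appeal to the
   spectral theorem is needed. *)
have := posdef_neq0 (mean_posdef mean pA pB); rewrite {1}sAB => s0.
have [U [a AU]] : exists U l, diagonalizes A U l.
  apply: (@mxfun_neq0 _ _ (fun t => t `^ 2^-1)); apply: contra_neq s0.
  by rewrite /mxpow => ->; rewrite mulmx0.
have [V0 [l0 XU0]] : exists V l, diagonalizes X V l.
  by apply: (@mxfun_neq0 _ _ f); apply: contra_neq s0 => ->; rewrite mulmx0 mul0mx.
(* Diagonalizing with the very row that [eigenvalues] selects makes [eigdet X] the product of its
   entries by definition. *)
have [V XV] := eigenvaluesP XU0; set m := eigenvalues X in XV.
pose i0 : 'I_3 := ord0; pose i1 : 'I_3 := lift ord0 ord0.
pose i2 : 'I_3 := ord_max.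
have TE : T = m ord0 i0 + m ord0 i1 + m ord0 i2.
  rewrite /T (eigtrE XV) !big_ord_recr big_ord0 /= add0r.
  by congr (m _ _ + m _ _ + m _ _); apply: val_inj.
have dE : d = m ord0 i0 * m ord0 i1 * m ord0 i2.
  rewrite /d /eigdet -/m !big_ord_recr big_ord0 /= mul1r.
  by congr (m _ _ * m _ _ * m _ _); apply: val_inj.
have SE : S = (T ^+ 2 - (m ord0 i0 ^+ 2 + m ord0 i1 ^+ 2 + m ord0 i2 ^+ 2)) / 2.
  rewrite /S (eigtrE (diagonalizes_mulmx XV)) -/T; congr ((_ - _) / _).
  rewrite !big_ord_recr big_ord0 /= add0r !mxE.
  by congr (m _ _ ^+ 2 + m _ _ ^+ 2 + m _ _ ^+ 2); apply: val_inj.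
have i3 (i : 'I_3) : [\/ i = i0, i = i1 | i = i2].
  by case: i => [[|[|[|]]]] // ?; [apply: Or31|apply: Or32|apply: Or33]; apply: val_inj.
have SpecX : Spec X = [set (m ord0 i0)%:A; (m ord0 i1)%:A; (m ord0 i2)%:A].
  rewrite (Spec_diagonalizes XV); apply/seteqP; split=> [_ [i _ <-]|x].
    by case: (i3 i) => ->; [left; left|left; right|right].
  by move=> [[->|->]|->]; [exists i0|exists i1|exists i2].
(* This distinctness makes p negative in [cardano_roots]. *)
have m01 : m ord0 i0 != m ord0 i1.
  have := cardX; rewrite SpecX => card3; have [ne _ _] := card3_neq card3.
  by apply: contra_notN ne => /eqP ->.
have lprod x : (x - l1) * (x - l2) * (x - l3)
             = (x - m ord0 i0) * (x - m ord0 i1) * (x - m ord0 i2).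
  by rewrite -(cardano_roots (m ord0 i2) x m01) /l1 /l2 /l3 /lambda
    /theta /q /p SE dE TE.
(* The two monic cubics have the same zeros, so the lists have the same members; the order in which
   [m] lists the eigenvalues is left open. *)
have memE x : (x \in [:: l1; l2; l3]) = (x \in [:: m ord0 i0; m ord0 i1; m ord0 i2]).
  by rewrite !inE -!(subr_eq0 x) !orbA -!mulf_eq0 lprod.
have SpecE : Spec X = [set l1%:A; l2%:A; l3%:A].
  have setE (x y z : R) : [set x%:A; y%:A; z%:A] =
      [set r%:A | r in [set r | r \in [:: x; y; z]]] :> set (scalars R k).
    apply/seteqP; split=> [_ [[->|->]|->]|_ [r rs <-]] /=.
    - by exists x => //=; rewrite !inE eqxx.
    - by exists y => //=; rewrite !inE eqxx orbT.
    - by exists z => //=; rewrite !inE eqxx !orbT.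
    - have : r \in [:: x; y; z] by [].
      by rewrite !inE => /or3P[] /eqP ->; [left; left|left; right|right].
  rewrite SpecX !setE; congr (_ @` _).
  by apply/seteqP; split=> r; rewrite /mkset/= memE.
split=> //.
(* The roots are distinct because the spectrum they form has three elements; the cosines are not
   compared. *)
have [l12 l13 l23] : [/\ l1 != l2, l1 != l3 & l2 != l3].
  have := cardX; rewrite SpecE => card3.
  have [n12 n13 n23] := card3_neq card3.
  by split; [move: n12|move: n13|move: n23]; apply: contra_notN => /eqP ->.
have fX : mxfun f X = c0%:A *: 1%:M + c1%:A *: X + c2%:A *: (X *m X).
  (* Every diagonal entry of X is one of the nodes l1, l2, l3, where the interpolant agrees with
     [f]. *)
  apply: (mxfun_quadratic XV) => i; apply: lagrange3 => //.
  by rewrite memE !inE; case: (i3 i) => ->; rewrite eqxx ?orbT.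
rewrite sAB fX; apply: conj_quadratic.
  rewrite (mxpowD _ _ pA AU) (_ : _ + _ = 1) ?(mxpow1 pA AU)//.
  by field.
by split; rewrite (mxpowD _ _ pA AU) ?addNr ?subrr (mxpow0 AU).
Qed.
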